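(* Let $E\subseteq\mathbb{Z}$. (i) If $E$ has positive maximal density, then there is an $a\in\mathbb{Z}$ such that $E\cup\{a\}$ fails real $(\mathcal{J}_2)$. Therefore $E$ fails real $(\mathcal{J}_3)$. (ii) If $d^*(E)>1/2$, then $E$ fails real $(\mathcal{J}_2)$.
   Context: The maximal density of $E$ is $d^*(E)=\lim_{h\to\infty}\max_{a\in\mathbb{Z}}\frac{|E\cap\{a+1,\dots,a+h\}|}{h}$. For $n\ge1$, $E$ enjoys real $(\mathcal{J}_n)$ if for all $m\ge1$, all $\zeta\in(\mathbb{Z}\setminus\{0\})^m$ with $\sum_{i=1}^m\zeta_i=0$ and $\sum_{i=1}^m|\zeta_i|\le2n$, all $1\le j\le m$ with $\zeta_1+\dots+\zeta_j$ odd, and all given $p_1,\dots,p_j\in E$, there is a finite $G\subseteq E$ such that $\zeta_1p_1+\dots+\zeta_mp_m\ne0$ for all $p_{j+1},\dots,p_m\in E\setminus G$. ''Fails'' means does not enjoy. *)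

(* Defs.v *)
From mathcomp Require Import all_boot all_order all_algebra.
From mathcomp Require Import all_classical all_reals all_analysis.

Set Implicit Arguments.
Unset Strict Implicit.
Unset Printing Implicit Defensive.

Import Order.TTheory GRing.Theory Num.Theory.
Import numFieldNormedType.Exports.
Local Open Scope classical_set_scope.
Local Open Scope ring_scope.

(* The cardinal of E `&` {a + 1, ..., a + h}, counted through the bijection
   i |-> a + (i + 1) from 'I_h onto the window. *)
Definition window_card (E : set int) (a : int) (h : nat) : nat :=
  #|[pred i : 'I_h | `[< E (a + i.+1%:Z) >]]|.

Lemma window_card_attained (E : set int) (h : nat) :
  exists k, `[< exists a : int, window_card E a h = k >].
Proof. by exists (window_card E 0 h); apply/asboolP; exists 0. Qed.

Lemma window_card_le (E : set int) (h k : nat) :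
  `[< exists a : int, window_card E a h = k >] -> (k <= h)%N.
Proof. by move=> /asboolP[a <-]; rewrite -[leqRHS]card_ord max_card. Qed.

Definition max_window_card (E : set int) (h : nat) : nat :=
  ex_maxn (window_card_attained E h) (@window_card_le E h).

(* The limit always exists: max_window_card E is subadditive, so Fekete's
   lemma applies.  The term h = 0 is the irrelevant value 0 / 0 = 0. *)
Definition max_density (R : realType) (E : set int) : R :=
  limn (fun h : nat => (max_window_card E h)%:R / h%:R : R).

(* Indices are shifted by one: zeta i and p i stand for zeta_{i+1} and p_{i+1},
   so that i < j selects the first j of them.  The values p i with j <= i are
   irrelevant; q extends p_1, ..., p_j to a full family.  As in the source,
   the p_i need not be distinct. *)
Definition real_J (n : nat) (E : set int) : Prop :=
  forall (m : nat) (zeta : 'I_m -> int),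
    (1 <= m)%N ->
    (forall i, zeta i != 0) ->
    \sum_(i < m) zeta i = 0 ->
    \sum_(i < m) `|zeta i| <= (2 * n)%:Z ->
  forall j : nat, (1 <= j <= m)%N ->
    ~~ (2 %| \sum_(i < m | (i < j)%N) zeta i)%Z ->
  forall p : 'I_m -> int, (forall i : 'I_m, (i < j)%N -> E (p i)) ->
  exists G : set int, [/\ finite_set G, G `<=` E &
    forall q : 'I_m -> int,
      (forall i : 'I_m, (i < j)%N -> q i = p i) ->
      (forall i : 'I_m, (j <= i)%N -> (E `\` G) (q i)) ->
      \sum_(i < m) zeta i * q i <> 0].

(* Main.v *)
(** Call [d] a recurrent difference of [E] if [z] and [z + d] both lie in [E] for
    infinitely many [z].  If [E] has positive maximal density, some [a] in [E] is
    such that [a - q] is a recurrent difference for infinitely many [q] in [E]: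
    otherwise one picks greedily arbitrarily many points [x] of [E] whose translates
    [E - x] meet pairwise in finite sets, and too many such translates do not
    fit in a long window.  For this [a], the equation [a = q + z' - z] has solutions
    [q, z, z'] in [E] outside of any finite set, so that [E] itself already fails
    real (J_2).  All the claims follow, since one may adjoin [a] in [E], and real
    (J_3) is stronger than real (J_2). *)
Require Import Defs.
From mathcomp Require Import all_boot all_order all_algebra.
From mathcomp Require Import all_classical all_reals all_analysis.
From mathcomp Require Import zify ring.

Set Implicit Arguments.
Unset Strict Implicit.
Unset Printing Implicit Defensive.

Import Order.TTheory GRing.Theory Num.Theory.
Import numFieldNormedType.Exports.
Local Open Scope classical_set_scope.
Local Open Scope ring_scope.

Lemma window_card_sum (E : set int) (a : int) (h : nat) :
  window_card E a h = (\sum_(i < h) `[< E (a + i.+1%:Z)%R >])%N.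
Proof. by rewrite /window_card -sum1_card big_mkcond. Qed.

Lemma window_card_max (E : set int) (a : int) (h : nat) :
  (window_card E a h <= h)%N.
Proof. by rewrite -[leqRHS]card_ord max_card. Qed.

Lemma window_cardUI (A B : set int) (a : int) (h : nat) :
  (window_card (A `|` B) a h + window_card (A `&` B) a h
   = window_card A a h + window_card B a h)%N.
Proof.
rewrite !window_card_sum -!big_split; apply: eq_bigr => i _ /=.
by rewrite asbool_or asbool_and; case: asboolP; case: asboolP.
Qed.

Lemma window_card_finite (A : set int) : finite_set A ->
  exists C, forall a h, (window_card A a h <= C)%N.
Proof.
move=> /finite_seqP[s As]; exists (size s) => a h.
pose g (i : 'I_h) := a + i.+1%:Z.
have g_inj : injective g.
  by move=> i j /addrI[ij]; apply: val_inj.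
rewrite /window_card cardE -(size_map g); apply: uniq_leq_size.
  by rewrite map_inj_uniq // enum_uniq.
by move=> _ /mapP[i + ->]; rewrite mem_enum inE As.
Qed.

(** Both sides count [E] in [{a + 1, ..., a + h + 1}], splitting off the first or the last point. *)
Lemma window_card_shift1 (E : set int) (a : int) (h : nat) :
  (window_card E (a + 1)%R h + `[< E (a + 1)%R >]
   = window_card E a h + `[< E (a + h.+1%:Z)%R >])%N.
Proof.
rewrite !window_card_sum.
pose F (i : nat) := nat_of_bool `[< E (a + i.+1%:Z) >].
transitivity (\sum_(i < h.+1) F i)%N; last by rewrite big_ord_recr.
rewrite big_ord_recl [RHS]addnC; congr addn; apply: eq_bigr => i _.
by rewrite /F lift0 -addrA.
Qed.

Lemma window_card_shift (E : set int) (a x : int) (h : nat) :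
  (window_card E a h <= window_card E (a + x)%R h + `|x|)%N.
Proof.
(* Both inequalities are needed: for [x < 0], the window at [a] is a forward shift of the one at
   [a + x]. *)
have shift_nat b n :
    (window_card E b h <= window_card E (b + n%:Z)%R h + n)%N /\
    (window_card E (b + n%:Z)%R h <= window_card E b h + n)%N.
  elim: n => [|n [IH1 IH2]]; first by rewrite addr0 addn0.
  have := window_card_shift1 E (b + n%:Z) h.
  have -> : b + n%:Z + 1 = b + n.+1%:Z by lia.
  by case: asboolP; case: asboolP => _ _ /=; lia.
case: x => n /=; first by case: (shift_nat a n).
case: (shift_nat (a + Negz n) n.+1) => _.
by have -> : a + Negz n + n.+1%:Z = a by lia.
Qed.

Definition recurrent_difference (E : set int) (d : int) : Prop :=
  infinite_set [set z | E z /\ E (z + d)].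

(** Inclusion-exclusion, adding one translate [E - x] at a time: its overlap with the earlier ones
    is finite, and shifting its window back to that of [E] costs at most [|x|]. Hence [C] depends on
    [s] but not on the window. *)
Lemma window_card_almost_disjoint (E : set int) (s : seq int) :
  pairwise (fun x y => `[< ~ recurrent_difference E (y - x) >]) s ->
  exists C, forall a h,
    (size s * window_card E a h
     <= window_card [set z | exists2 x, x \in s & E (z + x)%R] a h + C)%N.
Proof.
elim: s => [|x s IH] /=; first by exists 0%N.
move=> /andP[/allP xs /IH[C HC]].
pose U := [set z | exists2 y, y \in s & E (z + y)].
pose V := [set z | E (z + x)].
have finI : finite_set (V `&` U).
  have -> : V `&` U = \bigcup_(y in [set` s]) [set z | E (z + x) /\ E (z + y)].
    apply/seteqP; split => z /=; first by move=> [Vz [y ys Ey]]; exists y.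
    by move=> [y ys [Vz Ey]]; split => //; exists y.
  apply: bigcup_finite => // y /= /xs /asboolP /contrapT fin.
  apply: sub_finite_set (finite_image (fun z => z - x) fin) => z /= [Ex Ey].
  exists (z + x); last by rewrite addrK.
  by split => //; have -> : z + x + (y - x) = z + y by ring.
have [D HD] := window_card_finite finI.
exists (C + D + `|x|)%N => a h.
have -> : [set z | exists2 y, y \in x :: s & E (z + y)] = V `|` U.
  apply/seteqP; split => z /=.
    move=> [y]; rewrite inE => /orP[/eqP->|ys] Ey; first by left.
    by right; exists y.
  move=> [Ex|[y ys Ey]]; first by exists x; rewrite ?mem_head.
  by exists y; rewrite // inE ys orbT.
have VE : window_card V a h = window_card E (a + x) h.
  rewrite !window_card_sum; apply: eq_bigr => i _.
  by rewrite /V /= addrAC.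
have := window_cardUI V U a h; have := HD a h; have := HC a h.
have := window_card_shift E a x h.
rewrite -/U VE mulSn; set p := (size s * _)%N.
move: (window_card _ _ _) (window_card _ _ _) (window_card _ _ _)
  (window_card _ _ _) (window_card _ _ _) p `|x|%N; lia.
Qed.

Lemma max_window_cardP (E : set int) (h : nat) :
  exists a, window_card E a h = max_window_card E h.
Proof. by rewrite /max_window_card; case: ex_maxnP => k /asboolP. Qed.

(** If no [N] worked, the quotients defining the density would converge to 0. *)
Lemma max_density_gt0 (R : realType) (E : set int) : 0 < max_density R E ->
  exists N, forall H, exists h a, (H <= h)%N /\ (h <= N * window_card E a h)%N.
Proof.
move=> d_gt0; apply: contrapT => noN.
suff : (fun h => (max_window_card E h)%:R / h%:R : R) @ \oo --> (0 : R).
  by move=> /cvg_lim cvg0; move: d_gt0; rewrite /max_density cvg0 ?ltxx.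
apply/cvgrPdist_lt => e e0.
have [N HN] : exists N : nat, e^-1 < N%:R.
  by exists (Num.bound e^-1); apply: archi_boundP; rewrite invr_ge0 ltW.
have [H HH] : exists H, forall h a, (H <= h)%N -> (N * window_card E a h < h)%N.
  apply: contrapT => noH; apply: noN; exists N => H.
  apply: contrapT => noha; apply: noH; exists H => h a Hh.
  by rewrite ltnNge; apply/negP => le; apply: noha; exists h, a.
exists H => // h /= Hh; have [a <-] := max_window_cardP E h.
have lth := HH h a Hh.
have h0 : 0 < h%:R :> R by rewrite ltr0n (leq_ltn_trans _ lth).
rewrite sub0r normrN ger0_norm ?divr_ge0 // ltr_pdivrMr //.
rewrite -ltr_pdivrMl //.
have [->|w0] := posnP (window_card E a h); first by rewrite mulr0.
have := lth; rewrite -(ltr_nat R) natrM; apply: le_lt_trans.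
by rewrite ler_wpM2r // ltW.
Qed.

Lemma infinite_recurrent_difference (R : realType) (E : set int) :
  0 < max_density R E ->
  exists2 a, E a & infinite_set [set q | E q /\ recurrent_difference E (a - q)].
Proof.
move=> /max_density_gt0[N HN]; apply: contrapT => noa.
have infE : infinite_set E.
  move=> /window_card_finite[C HC].
  (* A count bounded by [C] would give [h <= N * C]. *)
  have [h [a [Hh le]]] := HN (N * C).+1.
  by have := leq_mul (leqnn N) (HC a h); lia.
have greedy k : exists s : seq int, [/\ size s = k, {in s, forall x, E x} &
    pairwise (fun x y => `[< ~ recurrent_difference E (y - x) >]) s].
  elim: k => [|k [s [sk sE sP]]]; first by exists [::].
  (* The points that cannot be added to [s]: finitely many for each [y] in [s], since no [y] in [E]
     has the desired property. *)
  pose B := \bigcup_(y in [set` s]) [set q | E q /\ recurrent_difference E (y - q)].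
  have finB : finite_set B.
    apply: bigcup_finite => // y /= /sE Ey.
    by apply: contrapT => inf; apply: noa; exists y.
  have [x [Ex Bx]] : E `\` B !=set0.
    by apply: infinite_setN0; apply: infinite_setD.
  exists (x :: s); split; first by rewrite /= sk.
    by move=> y; rewrite inE => /orP[/eqP->|/sE].
  rewrite /= sP andbT; apply/allP => y ys; apply/asboolP => rec.
  by apply: Bx; exists y.
(* With [N + 1] translates, [(N + 1) * w <= h + C] and [h <= N * w] force [w <= C], so [h <= N * C],
   against the choice of [h]. *)
have [s [sN _ /window_card_almost_disjoint[C HC]]] := greedy N.+1.
have [h [a [Hh le]]] := HN (N * C).+1.
have := HC a h; have := window_card_max [set z | exists2 x, x \in s & E (z + x)] a h.
rewrite sN; set w := window_card _ _ _ in le *; set u := window_card _ _ _.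
nia.
Qed.

Lemma real_J_le (n n' : nat) (E : set int) :
  (n <= n')%N -> real_J n' E -> real_J n E.
Proof.
move=> nn' J m zeta m1 z0 sz szn; apply: J => //.
by apply: le_trans szn _; rewrite lez_nat leq_mul2l.
Qed.

Lemma max_density_gt0_not_real_J2 (R : realType) (E : set int) :
  0 < max_density R E -> ~ real_J 2 E.
Proof.
move=> /infinite_recurrent_difference[a Ea inf_a] J.
(* These encode [a - q - z' + z = 0]: the absolute values add up to 4, and with only [a] prescribed
   the partial sum is 1, which is odd. *)
pose zeta (i : 'I_4) : int := [:: 1; -1; -1; 1]`_i.
have sum4 (F : 'I_4 -> int) : \sum_i F i = F 0 + F 1 + F 2 + F 3.
  rewrite !big_ord_recl big_ord0 addr0 !addrA.
  by congr (F _ + F _ + F _ + F _); apply: val_inj.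
have [|||||G [finG _ HG]] := J 4%N zeta isT _ _ _ 1%N isT _ (fun=> a) _.
- by case=> [[|[|[|[|]]]]].
- by rewrite sum4.
- by rewrite sum4.
- by rewrite big_mkcond sum4.
- by [].
have [q [[Eq rec] Gq]] : [set q | E q /\ recurrent_difference E (a - q)] `\` G !=set0.
  by apply: infinite_setN0; apply: infinite_setD.
(* Once [q] is fixed, avoiding [G'] keeps [z' = z + (a - q)] outside [G]. *)
pose G' := [set z - (a - q) | z in G].
have [z [[Ez Ezd] /not_orP[Gz G'z]]] :
    [set z | E z /\ E (z + (a - q))] `\` (G `|` G') !=set0.
  apply: infinite_setN0; apply: infinite_setD => //.
  by rewrite finite_setU; split => //; apply: finite_image.
apply: (HG (fun i : 'I_4 => [:: a; q; z + (a - q); z]`_i)).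
- by case=> [[|[|[|[|]]]]].
- case=> [[|[|[|[|]]]]] //= _ _; split => // Gzd.
  by apply: G'z; exists (z + (a - q)); rewrite ?addrK.
- by rewrite sum4 /zeta /=; ring.
Qed.

Theorem proposition11p2 (R : realType) (E : set int) :
  (0 < max_density R E ->
     (exists a : int, ~ real_J 2 (E `|` [set a])) /\ ~ real_J 3 E)
  /\ (1 / 2 < max_density R E -> ~ real_J 2 E).
Proof.
split=> [d_gt0|d_gt].
  have nJ := max_density_gt0_not_real_J2 d_gt0.
  split; last by move=> /(@real_J_le 2 3 E isT).
  have [a Ea _] := infinite_recurrent_difference d_gt0; exists a.
  by rewrite (_ : E `|` [set a] = E) //; apply/setUidPl => _ ->.
by apply: (@max_density_gt0_not_real_J2 R); apply: lt_trans d_gt; rewrite divr_gt0.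
Qed.
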